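(* If $\epsilon_1\ge\epsilon_2\ge\epsilon_3\ge\cdots$ is a sequence of positive real numbers with $\epsilon_k$ approaching $0$, then $$\sup_{\ell\in\mathbb{Z}}\sum_{k=1}^\infty\left|\widehat\psi_{\epsilon_k}(\ell)-\widehat\psi_{\epsilon_{k+1}}(\ell)\right|<\infty.$$
   Context: For $\epsilon>0$, $\varphi_\epsilon$ is the function on the circle given by $\varphi_\epsilon(e^{i\theta})=\frac1{2\epsilon}$ for $-\epsilon\le\theta\le\epsilon$ and $0$ otherwise, with Fourier coefficients $\widehat\varphi_\epsilon(\ell)=\frac{\sin(\ell\epsilon)}{\ell\epsilon}$, $\ell\in\mathbb{Z}$ (equal to $1$ at $\ell=0$). Put $\psi_\epsilon=\varphi_\epsilon*\varphi_\epsilon$, so $\widehat\psi_\epsilon(\ell)=\widehat\varphi_\epsilon(\ell)^2$. *)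

(* Defs.v *)
From mathcomp Require Import all_boot all_order all_algebra.
From mathcomp Require Import all_classical all_reals all_analysis.
From mathcomp Require Import complex.

Set Implicit Arguments.
Unset Strict Implicit.
Unset Printing Implicit Defensive.

Import Order.TTheory GRing.Theory Num.Theory.
Import numFieldNormedType.Exports.

Local Open Scope classical_set_scope.
Local Open Scope ring_scope.

(* A function F on the unit circle is represented by the 2 pi-periodic function
   t |-> F (e^{it}) on the reals.  Integrals over the circle are taken with
   respect to dt, unnormalised: this is the convention under which the
   coefficients of varphi eps are sin (l eps) / (l eps), with value 1 at l = 0,
   and those of a convolution are the products of the coefficients. *)

Definition bump (R : realType) (eps t : R) : R :=
  if - eps <= t <= eps then (2 * eps)^-1 else 0.

(* For eps < pi at most one term of the (finitely supported) sum is nonzero, and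
   varphi eps t = (2 eps)^-1 exactly when e^{it} = e^{is} for some
   s in [- eps, eps].  For eps > pi the arc overlaps itself, and the overlaps
   have to be added up for sin (l eps) / (l eps) to be the coefficients. *)
Definition varphi (R : realType) (eps t : R) : R :=
  \sum_(n \in [set: int]) bump eps (t + n%:~R * (2 * pi)).

Definition conv (R : realType) (f g : R -> R) (t : R) : R :=
  \int[@lebesgue_measure R]_(s in `[- pi, pi]) (f (t - s) * g s).

(* integral of f t * e^{- i l t}, as real and imaginary parts, f being real *)
Definition fourier_coef (R : realType) (f : R -> R) (l : int) : R[i] :=
  Complex
    (\int[@lebesgue_measure R]_(t in `[- pi, pi]) (f t * cos (l%:~R * t)))
    (- \int[@lebesgue_measure R]_(t in `[- pi, pi]) (f t * sin (l%:~R * t))).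

Definition psi (R : realType) (eps : R) : R -> R :=
  conv (varphi eps) (varphi eps).

(* Main.v *)
Require Import Defs.
From mathcomp Require Import all_boot all_order all_algebra.
From mathcomp Require Import all_classical all_reals all_analysis.
From mathcomp Require Import complex zify ring lra.

(** For small [eps] the coefficients of [psi eps] are the values of
    [sinc2 x = (sin x / x) ^ 2] at [x = l * eps], so that for fixed [l] the sum
    measures the oscillation of [sinc2] along the nonincreasing sequence
    [|l| * eps k].  It is therefore at most the total variation of [sinc2] on
    the positive half-line, which is finite because the derivative of [sinc2]
    is [O((1 + x) ^ -2)].  Concretely, [le_variation_sinc2] compares the
    increments of [sinc2] with those of [- 16 / (1 + x)], and the latter
    telescope to a bound by 16 in which [l] has disappeared.

    The identification of the coefficients needs no Fubini argument.  When
    [2 * eps < pi] the arcs do not wrap around the circle, and the convolution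
    is the explicit tent [(2 eps - |t|)^+ / (2 eps) ^ 2] on [- pi, pi]
    ([psi_tent]).  Integrating a tent against [f] only involves a second
    antiderivative [F] of [f], through a second difference of [F]
    ([Rintegral_tent]); for [f t = cos (l t)] this gives [sinc2 (l * eps)].

    Only finitely many [eps k] fail to be small.  Each of them contributes a
    term that is bounded in [l], because [psi eps] is bounded
    ([fourier_psi_bounded]).  *)

Import Order.TTheory GRing.Theory Num.Theory.
Import numFieldNormedType.Exports.

Set Implicit Arguments.
Unset Strict Implicit.
Unset Printing Implicit Defensive.

Local Open Scope classical_set_scope.
Local Open Scope ring_scope.

(** * The variation of the squared cardinal sine *)

(** Both [g - f] and [g + f] have a nonnegative derivative, so the increment of
    [g] dominates those of [f] and of [- f]. *)
Lemma le_variation_of_derive (R : realType) (f g df dg : R -> R) (a b : R) :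
    a <= b ->
    (forall t, a <= t <= b -> is_derive t 1 f (df t)) ->
    (forall t, a <= t <= b -> is_derive t 1 g (dg t)) ->
    (forall t, a <= t <= b -> `|df t| <= dg t) ->
  `|f b - f a| <= g b - g a.
Proof.
move=> ab f' g' fg.
have mono (h dh : R -> R) : (forall t, a <= t <= b -> is_derive t 1 h (dh t)) ->
    (forall t, a <= t <= b -> 0 <= dh t) -> h a <= h b.
  move=> h' dh0.
  have [||c] := @MVT_segment R h dh a b ab.
  - by move=> x /[!in_itv]/= /andP[ax xb]; apply: h'; rewrite !ltW.
  - apply: derivable_within_continuous => x /[!in_itv]/= /h' ?.
    exact: ex_derive.
  - rewrite in_itv/= => cab hE; rewrite -subr_ge0 hE mulr_ge0 ?subr_ge0//.
    exact: dh0.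
rewrite ler_norml; apply/andP; split.
- have /= := mono (g + f) (dg + df)
    (fun t tab => is_deriveD (g' t tab) (f' t tab)).
  rewrite !fctE => H; suff : g a + f a <= g b + f b by lra.
  by apply: H => t /fg; rewrite ler_norml => /andP[]; lra.
- have /= := mono (g - f) (dg - df)
    (fun t tab => is_deriveB (g' t tab) (f' t tab)).
  rewrite !fctE => H; suff : g a - f a <= g b - f b by lra.
  by apply: H => t /fg; rewrite ler_norml => /andP[]; lra.
Qed.

Lemma ler_norm_sin (R : realType) (x : R) : 0 <= x -> `|sin x| <= x.
Proof.
move=> x0.
have := @le_variation_of_derive R sin id cos (cst 1) 0 x x0.
by rewrite sin0 !subr0; apply=> t _; exact: cos_max.
Qed.

(** The derivative of [t * cos t - sin t] is [- t * sin t], of size at most [t].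
    The quadratic decay at 0 is what keeps the derivative of [sinc2] bounded
    there. *)
Lemma ler_norm_xcosBsin (R : realType) (x : R) : 0 <= x ->
  `|x * cos x - sin x| <= x ^+ 2 / 2.
Proof.
move=> x0.
pose f : R -> R := id * cos - sin; pose g : R -> R := 2^-1 *: (id * id).
have : `|f x - f 0| <= g x - g 0.
  apply: (@le_variation_of_derive R f g (fun t => - (t * sin t)) id) => // t.
  - by move=> _; apply: is_derive_eq; rewrite /GRing.scale/=; ring.
  - by move=> _; apply: is_derive_eq; rewrite /GRing.scale/=; field.
  - by move=> /andP[t0 _]; rewrite normrN normrM ger0_norm// ler_piMr// sin_max.
rewrite /f /g !fctE /= sin0 mul0r !subr0 /GRing.scale/= !mulr0 subr0.
by rewrite expr2 [_ / 2]mulrC.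
Qed.

(** Since [x / 0 = 0], this takes the value 0 rather than its limit 1 at the
    origin; the coefficient of index 0 is dealt with apart. *)
Definition sinc2 {R : realType} (x : R) : R := (sin x / x) ^+ 2.

Lemma is_derive_sinc2 (R : realType) (x : R) : 0 < x ->
  is_derive x 1 (@sinc2 R) (2 * sin x * (x * cos x - sin x) / x ^+ 3).
Proof.
move=> x0; have xn0 : x != 0 by rewrite gt_eqF.
have -> : @sinc2 R = (sin * (fun y => y^-1)) ^+ 2 by apply/funext.
have dV : is_derive x 1 (fun y : R => y^-1) (- x ^- 2).
  by have := @is_deriveV _ id x 1 1 xn0 _; rewrite /GRing.scale/= mulr1; apply.
by apply: is_derive_eq; rewrite fctE /GRing.scale/=; field.
Qed.

(** The derivative of [sinc2] is compared with that of [- 16 / (1 + t)]: near 0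
    it is at most 1 by [ler_norm_xcosBsin], and beyond 1 it is at most
    [2 * (1 + t) / t ^ 3] because sine and cosine are at most 1. *)
Lemma le_variation_sinc2 (R : realType) (x y : R) : 0 < y -> y <= x ->
  `|sinc2 x - sinc2 y| <= 16 * ((1 + y)^-1 - (1 + x)^-1).
Proof.
move=> y0 yx.
pose g : R -> R := (-16) *: (fun t : R => (1 + t)^-1).
suff : `|sinc2 x - sinc2 y| <= g x - g y.
  by move=> /le_trans; apply; rewrite /g !fctE /GRing.scale/=; lra.
apply: (@le_variation_of_derive R sinc2 g
  (fun t => 2 * sin t * (t * cos t - sin t) / t ^+ 3)
  (fun t => 16 / (1 + t) ^+ 2) y x yx) => t /andP[yt _].
- by apply: is_derive_sinc2; exact: lt_le_trans yt.
- have t1 : 1 + t != 0 by rewrite gt_eqF// ltr_wpDr// (le_trans _ yt)// ltW.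
  have d1 : is_derive t 1 (fun t : R => 1 + t) 1.
    by apply: is_derive_eq; rewrite add0r mulr1.
  have := @is_deriveV _ _ t 1 1 t1 d1; rewrite /GRing.scale/= mulr1 => dV.
  by apply: is_derive_eq; rewrite /GRing.scale/=; field.
have t0 : 0 < t by exact: lt_le_trans yt.
rewrite normrM normfV [`|t ^+ 3|]gtr0_norm ?exprn_gt0//.
rewrite !normrM (ger0_norm (_ : 0 <= 2))//.
have [t1|/ltW t1] := leP t 1.
(* [|sin t| <= t] and [|t cos t - sin t| <= t ^ 2 / 2] *)
- have : 2 * `|sin t| * `|t * cos t - sin t| / t ^+ 3 <= 1.
    rewrite ler_pdivrMr ?exprn_gt0// mul1r.
    apply: (@le_trans _ _ (2 * t * (t ^+ 2 / 2))).
      apply: ler_pM => //.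
      + by rewrite ler_pM2l// ler_norm_sin// ltW.
      + by rewrite ler_norm_xcosBsin// ltW.
    by rewrite le_eqVlt; apply/orP; left; apply/eqP; field.
  move=> /le_trans; apply; rewrite ler_pdivlMr ?mul1r ?exprn_gt0 ?ltr_wpDr//.
  + rewrite (_ : 16 = 4 ^+ 2); last by rewrite -natrX.
    by rewrite lerXn2r ?nnegrE//; lra.
  + exact: ltW.
- rewrite ler_pdivrMr ?exprn_gt0//.
  apply: (@le_trans _ _ (2 * 1 * (1 + t))).
    apply: ler_pM => //.
    + by rewrite ler_pM2l// sin_max.
    + rewrite (le_trans (ler_normB _ _))// addrC lerD ?sin_max//.
      by rewrite normrM ger0_norm ?(ltW t0)// ler_piMr ?cos_max// ltW.
  (* [1 + t <= 2 * t] turns the bound into the constant [2 * 2 ^ 3 = 16] *)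
  rewrite [leRHS]mulrAC ler_pdivlMr ?exprn_gt0 ?ltr_wpDr ?(ltW t0)//.
  have : (1 + t) ^+ 3 <= (2 * t) ^+ 3.
    by rewrite lerXn2r ?nnegrE//; lra.
  rewrite exprMn -natrX => t3; rewrite mulr1 -mulrA -exprS; move: t3.
  by move: ((1 + t) ^+ 3) (t ^+ 3) => v u; rewrite (_ : (2 ^ 3)%N = 8%N)//; lra.
Qed.

(** * Integrals against a tent *)

Lemma integrable_continuous_itv (R : realType) (f : R -> R) (a b : R) :
  continuous f ->
  (@lebesgue_measure R).-integrable `[a, b] (EFin \o f).
Proof.
move=> cf; apply: continuous_compact_integrable; first exact: segment_compact.
exact: continuous_subspaceT.
Qed.

Lemma Rintegral_FTC2 (R : realType) (F f : R -> R) (a b : R) : a < b ->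
    continuous f -> (forall t : R, is_derive t 1 F (f t)) ->
  \int[@lebesgue_measure R]_(t in `[a, b]) f t = F b - F a.
Proof.
move=> ab cf F'; have cF : continuous F.
  move=> t; apply/differentiable_continuous/derivable1_diffP.
  exact: ex_derive.
rewrite /Rintegral (@continuous_FTC2 R f F a b ab) //.
- exact: continuous_subspaceT.
- split; first by move=> t _; exact: ex_derive.
  + exact/cvg_at_right_filter/cF.
  + exact/cvg_at_left_filter/cF.
- by move=> t _; rewrite derive1E derive_val.
Qed.

(** On each half of the interval the tent is affine, and [(a - t) * G + F],
    respectively [(a + t) * G - F], is an antiderivative of the integrand; the
    values of [G] at 0 cancel. *)
Lemma Rintegral_tent (R : realType) (F G f : R -> R) (a : R) : 0 < a ->
    continuous f -> (forall t : R, is_derive t 1 G (f t)) ->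
    (forall t : R, is_derive t 1 F (G t)) ->
  \int[@lebesgue_measure R]_(t in `[- a, a]) ((a - `|t|) * f t)
  = F a + F (- a) - 2 * F 0.
Proof.
move=> a0 cf G' F'.
have ctent : continuous (fun t : R => (a - `|t|) * f t).
  move=> t; apply: cvgM; last exact: cf.
  by apply: cvgB; [exact: cvg_cst|exact: norm_continuous].
have clin (s : R) : continuous (fun t : R => (a + s * t) * f t).
  move=> t; apply: cvgM; last exact: cf.
  apply: cvgD; first exact: cvg_cst.
  by apply: cvgM; [exact: cvg_cst|exact: cvg_id].
have := @Rintegral_itvB R (fun t => (a - `|t|) * f t)
  (BLeft (- a)) (BRight a) 0.
move=> /(_ (integrable_continuous_itv _ _ ctent)).
rewrite !bnd_simp oppr_le0 (ltW a0) => /(_ isT isT).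
rewrite Rintegral_itv_obnd_cbnd; last first.
  apply: integrableS (integrable_continuous_itv 0 a ctent) => //.
  exact: subset_itv_oc_cc.
move=> /eqP; rewrite subr_eq => /eqP ->.
have -> : \int[@lebesgue_measure R]_(t in `[0, a]) ((a - `|t|) * f t)
    = F a - F 0 - a * G 0.
  under eq_Rintegral => t.
    rewrite inE/= in_itv/= => /andP[t0 _].
    rewrite ger0_norm// -mulN1r; over.
  have dH (t : R) : is_derive t 1 ((cst a - id) * G + F) ((a + -1 * t) * f t).
    by apply: is_derive_eq; rewrite /GRing.scale/= !fctE/=; ring.
  by rewrite (Rintegral_FTC2 a0 (clin _) dH) !fctE/=; ring.
have -> : \int[@lebesgue_measure R]_(t in `[- a, 0]) ((a - `|t|) * f t)
    = F (- a) - F 0 + a * G 0.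
  under eq_Rintegral => t.
    rewrite inE/= in_itv/= => /andP[_ t0].
    rewrite ler0_norm// opprK -[X in a + X]mul1r; over.
  have dH (t : R) : is_derive t 1 ((cst a + id) * G - F) ((a + 1 * t) * f t).
    by apply: is_derive_eq; rewrite /GRing.scale/= !fctE/=; ring.
  have Na0 : - a < 0 by rewrite oppr_lt0.
  by rewrite (Rintegral_FTC2 Na0 (clin _) dH) !fctE/=; ring.
ring.
Qed.

(** * The convolution and its coefficients for short arcs *)

Lemma bump_eq0 (R : realType) (eps t : R) : eps < `|t| -> Defs.bump eps t = 0.
Proof. by move=> et; rewrite /Defs.bump -ler_norml leNgt et. Qed.

(** The centres of the other translates of the arc are at distance at least
    [2 pi - |t|] from [t], which exceeds [eps]. *)
Lemma varphi_bump (R : realType) (eps t : R) : `|t| + eps < 2 * pi ->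
  varphi eps t = Defs.bump eps t.
Proof.
move=> teps; rewrite /varphi -(fsbig_widen [set 0])//=.
  by rewrite fsbig_set1 mul0r addr0.
move=> n [_ /= /eqP n0]; apply: bump_eq0.
have pi0 : 0 < 2 * pi :> R by rewrite mulr_gt0// pi_gt0.
have n1 : 2 * pi <= `|n%:~R * (2 * pi)| :> R.
  rewrite normrM (gtr0_norm pi0) ler_peMl ?(ltW pi0)//.
  by rewrite -intr_norm ler1z -gtz0_ge1 normr_gt0.
have : `|n%:~R * (2 * pi)| <= `|t + n%:~R * (2 * pi)| + `|t|.
  by rewrite -[X in `|X| <= _](addrK t) [_ + t]addrC ler_normB.
lra.
Qed.

(** The integrand is the constant [(2 eps) ^ -2] on the intersection of the
    intervals of radius [eps] around [t] and around 0, whose length is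
    [(2 eps - |t|)^+].  The condition [2 * eps < pi] keeps [t - s] within reach
    of the principal translate only, when [|s| <= eps]. *)
Lemma psi_tent (R : realType) (eps t : R) : 0 < eps -> 2 * eps < pi ->
    `|t| <= pi ->
  psi eps t = (2 * eps) ^- 2 * Num.max 0 (2 * eps - `|t|).
Proof.
move=> eps0 epspi tpi.
pose P : set R := `[t - eps, t + eps] `&` `[- eps, eps].
transitivity (\int[@lebesgue_measure R]_(s in `[- pi, pi] `&` P)
    ((2 * eps) ^- 2)).
  rewrite Rintegral_mkcondr /psi /conv; apply: eq_Rintegral => s.
  rewrite inE/= in_itv/= -ler_norml => spi.
  rewrite (varphi_bump (t := s)); last by lra.
  rewrite patchE; case: ifPn => [|sP].
    rewrite inE /P /= !in_itv/= => -[/andP[ts1 ts2] sE].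
    have se := sE; rewrite -ler_norml in se.
    rewrite varphi_bump /Defs.bump; last first.
      by have := ler_normB t s; lra.
    rewrite sE ifT ?expr2 ?invfM//; lra.
  have [se|es] := leP `|s| eps; last by rewrite (bump_eq0 es) mulr0.
  rewrite varphi_bump; last by have := ler_normB t s; lra.
  rewrite bump_eq0 ?mul0r// ltNge; apply: contra sP => tse.
  rewrite inE /P /= !in_itv/= -ler_norml; split => //.
  by move: tse; rewrite ler_norml; lra.
rewrite Rintegral_cst; last by do 2 apply: measurableI => //.
congr (_ * _).
have -> : `[- pi, pi] `&` P =
    `[Num.max (t - eps) (- eps), Num.min (t + eps) eps]%classic.
  apply/seteqP; split => s; rewrite /P /= !in_itv/= ge_max le_min.
    by move=> [_ [/andP[-> ->] /andP[-> ->]]].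
  move=> /andP[/andP[-> se1] /andP[-> se2]]; rewrite se1 se2; split => //.
  lra.
rewrite /= lebesgue_measure_itv/= lte_fin.
have [t0|/ltW t0] := leP 0 t.
  rewrite (ger0_norm t0) (max_idPl _) ?(min_idPr _); [|lra|lra].
  have [h|h] := ltP (t - eps) eps;
    have [h'|h'] := leP 0 (2 * eps - t) => /=; lra.
rewrite (ler0_norm t0) (max_idPr _) ?(min_idPl _); [|lra|lra].
have [h|h] := ltP (- eps) (t + eps);
  have [h'|h'] := leP 0 (2 * eps - - t) => /=; lra.
Qed.

(** A common form of the real and imaginary parts of the coefficients, where
    [f] is a cosine or a sine. *)
Lemma Rintegral_psi (R : realType) (F G f : R -> R) (eps : R) :
    0 < eps -> 2 * eps < pi ->
    continuous f -> (forall t : R, is_derive t 1 G (f t)) ->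
    (forall t : R, is_derive t 1 F (G t)) ->
  \int[@lebesgue_measure R]_(t in `[- pi, pi]) (psi eps t * f t)
  = (2 * eps) ^- 2 * (F (2 * eps) + F (- (2 * eps)) - 2 * F 0).
Proof.
move=> eps0 epspi cf G' F'; have a0 : 0 < 2 * eps by rewrite mulr_gt0.
rewrite -(Rintegral_tent a0 cf G' F') -RintegralZl//; last first.
  apply: integrable_continuous_itv => t; apply: cvgM; last exact: cf.
  by apply: cvgB; [exact: cvg_cst|exact: norm_continuous].
have <- : `[- pi, pi] `&` `[- (2 * eps), 2 * eps] =
    `[- (2 * eps), 2 * eps]%classic.
  by apply: setIidr; apply: subset_itv; rewrite bnd_simp; lra.
rewrite Rintegral_mkcondr; apply: eq_Rintegral => t.
rewrite inE/= in_itv/= -ler_norml => tpi.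
rewrite psi_tent// patchE; case: ifPn.
  rewrite inE/= in_itv/= -ler_norml => teps.
  by rewrite (max_idPr _) ?subr_ge0// mulrA.
rewrite notin_setE/= in_itv/= -ler_norml => /negP; rewrite -ltNge => teps.
by rewrite (max_idPl _) ?subr_le0 ?(ltW teps)// mulr0 mul0r.
Qed.

(** Here the integrands are the constants 1 and 0, whose second antiderivatives
    are [t ^ 2 / 2] and 0. *)
Lemma fourier_psi0 (R : realType) (eps : R) : 0 < eps -> 2 * eps < pi ->
  fourier_coef (psi eps) 0 = Complex 1 0.
Proof.
move=> eps0 epspi; have epsn0 : eps != 0 by rewrite gt_eqF.
congr Complex.
- under eq_Rintegral => t _ do rewrite mul0r cos0.
  have G' (t : R) : is_derive t 1 id (cst 1 t) by exact: is_derive_id.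
  have F' (t : R) : is_derive t 1 (2^-1 *: (id * id)) (id t).
    by apply: is_derive_eq; rewrite /GRing.scale/=; field.
  have cc : continuous (cst 1 : R -> R) by exact: cst_continuous.
  rewrite (Rintegral_psi eps0 epspi cc G' F').
  by rewrite !fctE /GRing.scale/=; field.
- under eq_Rintegral => t _ do rewrite mul0r sin0.
  have d0 (t : R) : is_derive t 1 (cst 0 : R -> R) (cst 0 t).
    exact: is_derive_cst.
  have cc : continuous (cst 0 : R -> R) by exact: cst_continuous.
  rewrite (Rintegral_psi eps0 epspi cc d0 d0).
  by rewrite !fctE; ring.
Qed.

(** The second difference of [- cos (L t) / L ^ 2] with step [2 * eps] is
    [2 * (1 - cos (2 L eps)) / L ^ 2 = 4 * sin (L eps) ^ 2 / L ^ 2]; that of the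
    odd function [- sin (L t) / L ^ 2] vanishes. *)
Lemma fourier_psi (R : realType) (eps : R) (l : int) :
    0 < eps -> 2 * eps < pi -> l != 0 ->
  fourier_coef (psi eps) l = Complex (sinc2 (l%:~R * eps)) 0.
Proof.
move=> eps0 epspi l0; have epsn0 : eps != 0 by rewrite gt_eqF.
rewrite /fourier_coef; set L : R := l%:~R.
have L0 : L != 0 by rewrite intr_eq0.
have dL (t : R) : is_derive t 1 (fun t => L * t) L.
  have := is_deriveZ L (is_derive_id t (1 : R)).
  by rewrite /GRing.scale/= mulr1.
have dcos (t : R) : is_derive t 1 (cos \o (fun t => L * t)) (- sin (L * t) * L).
  exact: is_derive1_comp.
have dsin (t : R) : is_derive t 1 (sin \o (fun t => L * t)) (cos (L * t) * L).
  exact: is_derive1_comp.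
have ccos : continuous (fun t => cos (L * t)).
  move=> t; apply: differentiable_continuous; apply/derivable1_diffP.
  exact: ex_derive.
have csin : continuous (fun t => sin (L * t)).
  move=> t; apply: differentiable_continuous; apply/derivable1_diffP.
  exact: ex_derive.
congr Complex.
- have G' (t : R) : is_derive t 1 (L^-1 *: (sin \o (fun t => L * t)))
      (cos (L * t)).
    by apply: is_derive_eq; rewrite /GRing.scale/=; field.
  have F' (t : R) : is_derive t 1 (- L ^- 2 *: (cos \o (fun t => L * t)))
      ((L^-1 *: (sin \o (fun t => L * t))) t).
    by apply: is_derive_eq; rewrite !fctE /GRing.scale/=; field.
  rewrite (Rintegral_psi eps0 epspi ccos G' F') !fctE /GRing.scale/=.
  have c2 : cos (L * (2 * eps)) = 1 - 2 * sin (L * eps) ^+ 2.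
    have -> : L * (2 * eps) = L * eps *+ 2 by ring.
    by rewrite cos_mulr2n cos2sin2; ring.
  by rewrite mulr0 cos0 [L * - _]mulrN cosN c2 /sinc2; field; rewrite epsn0.
- have G' (t : R) : is_derive t 1 (- L^-1 *: (cos \o (fun t => L * t)))
      (sin (L * t)).
    by apply: is_derive_eq; rewrite /GRing.scale/=; field.
  have F' (t : R) : is_derive t 1 (- L ^- 2 *: (sin \o (fun t => L * t)))
      ((- L^-1 *: (cos \o (fun t => L * t))) t).
    by apply: is_derive_eq; rewrite !fctE /GRing.scale/=; field.
  rewrite (Rintegral_psi eps0 epspi csin G' F') !fctE /GRing.scale/=.
  by rewrite mulr0 sin0 [L * - _]mulrN sinN; ring.
Qed.

(** * Bounds for arbitrary arcs *)

(** The integral of a nonnegative function is a supremum over the simple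
    functions below it, hence monotone without any measurability.  Stating the
    bound for arbitrary [f] avoids proving that [psi eps] is measurable. *)
Lemma ler_norm_Rintegral_bounded d (T : measurableType d) (R : realType)
    (mu : {measure set T -> \bar R}) (D : set T) (f : T -> R) (M : R) :
    measurable D -> (mu D < +oo)%E -> (forall x, D x -> `|f x| <= M) ->
  `|\int[mu]_(x in D) f x| <= M * fine (mu D).
Proof.
move=> mD Dfin fM.
have [D0|/set0P[x0 Dx0]] := eqVneq D set0.
  by rewrite D0 Rintegral_set0 measure0 normr0 mulr0.
have M0 : 0 <= M by apply: le_trans (fM _ Dx0).
have bound (g : T -> \bar R) : (forall x, 0 <= g x)%E ->
    (forall x, D x -> g x <= M%:E)%E ->
    (0 <= \int[mu]_(x in D) g x <= (M * fine (mu D))%:E)%E.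
  move=> g0 gM; apply/andP; split; first exact: integral_ge0.
  have -> : (M * fine (mu D))%:E = (\int[mu]_(x in D) cst M%:E x)%E.
    by rewrite integral_cst// EFinM fineK// ge0_fin_numE.
  rewrite !ge0_integralE//.
  apply: le_ereal_sup => _ [h hg <-]; exists h => // x.
  apply: le_trans (hg x) _; rewrite !patchE; case: ifPn => // xD.
  by apply: gM; rewrite -inE.
rewrite /Rintegral integralE.
have /bound/(_ _)/andP[|p0 pM] := funepos_ge0 (EFin \o f).
  move=> x Dx; rewrite funeposE ge_max !lee_fin M0 andbT.
  by apply: le_trans (fM _ Dx); exact: ler_norm.
have /bound/(_ _)/andP[|n0 nM] := funeneg_ge0 (EFin \o f).
  move=> x Dx; rewrite funenegE ge_max -EFinN !lee_fin M0 andbT.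
  by apply: le_trans (fM _ Dx); rewrite -normrN; exact: ler_norm.
move: p0 pM n0 nM.
move: (integral _ _ _) (integral _ _ _) => [p| |]// [n| |]//=.
rewrite !lee_fin ler_norml => p0 pM n0 nM; apply/andP; split; lra.
Qed.

(** Finitely many translates of the arc meet [- 2 pi, 2 pi].  This interval is
    the one to consider because it contains [t - s] for [s] and [t] in
    [- pi, pi]. *)
Lemma varphi_bounded (R : realType) (eps : R) : 0 < eps ->
  exists M : R, forall t, `|t| <= 2 * pi -> `|varphi eps t| <= M.
Proof.
move=> eps0.
(* as [N > eps + 1], a translate by [N] turns or more misses
   [- 2 pi, 2 pi] *)
pose N := Num.bound (eps + 1).
pose r : seq int :=
  undup ([seq Posz n | n <- iota 0 N] ++ [seq Negz n | n <- iota 0 N]).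
exists (\sum_(n <- r) (2 * eps)^-1) => t tpi.
have pi2 := pi_ge2 R.
rewrite /varphi -(fsbig_widen [set` r])//; last first.
  move=> n [_ /= nr]; apply: bump_eq0.
  have Nn : eps + 1 < `|n%:~R|.
    have epsN : eps + 1 < N%:R by apply: archi_boundP; lra.
    apply: lt_le_trans epsN _; rewrite -intr_norm pmulrn ler_int leNgt.
    apply/negP => nN; apply: nr; rewrite mem_undup mem_cat.
    by case: n nN => m mN; apply/orP; [left|right]; apply: map_f;
      rewrite mem_iota /=; move: mN; rewrite ?NegzE; lia.
  have npi : (eps + 1) * (2 * pi) < `|n%:~R * (2 * pi)|.
    rewrite normrM [X in _ < _ * X]gtr0_norm ?ltr_pM2r//; lra.
  have : `|n%:~R * (2 * pi)| <= `|t + n%:~R * (2 * pi)| + `|t|.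
    by rewrite -[X in `|X| <= _](addrK t) [_ + t]addrC ler_normB.
  have : eps <= eps * (2 * pi) by rewrite ler_peMr; lra.
  lra.
rewrite -fsbig_seq ?undup_uniq// (le_trans (ler_norm_sum _ _ _))//.
rewrite ler_sum// => n _; rewrite /Defs.bump; case: ifP => _.
  by rewrite ger0_norm ?invr_ge0//; lra.
by rewrite normr0 invr_ge0; lra.
Qed.

Lemma fourier_psi_bounded (R : realType) (eps : R) : 0 < eps ->
  exists B : R, forall l,
    ComplexField.Normc.normc (fourier_coef (psi eps) l) <= B.
Proof.
move=> /varphi_bounded [M varphiM].
set D : set R := `[- pi, pi]%classic; set m := fine (lebesgue_measure D).
have mD : measurable D by exact: measurable_itv.
have Dfin : (lebesgue_measure D < +oo)%E.
  by rewrite /D /= lebesgue_measure_itv/=; case: ifP; rewrite ltry.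
have M0 : 0 <= M.
  by apply: le_trans (varphiM 0 _) => //; rewrite normr0 mulr_ge0// pi_ge0.
have psiM t : D t -> `|psi eps t| <= M * M * m.
  rewrite /D /= in_itv/= -ler_norml => tpi.
  apply: ler_norm_Rintegral_bounded => // s.
  rewrite /D /= in_itv/= -ler_norml => spi.
  have pi0 := pi_ge0 R.
  rewrite normrM ler_pM// varphiM//; last lra.
  by have := ler_normB t s; lra.
pose B := M * M * m * m.
have fM (c : R -> R) : (forall t, `|c t| <= 1) ->
    (\int[lebesgue_measure]_(t in D) (psi eps t * c t)) ^+ 2 <= B ^+ 2.
  move=> c1.
  have cB : `|\int[lebesgue_measure]_(t in D) (psi eps t * c t)| <= B.
    apply: ler_norm_Rintegral_bounded => // t /psiM tM.
    by rewrite normrM -[leRHS]mulr1 ler_pM.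
  by rewrite -[leLHS]real_normK ?num_real// lerXn2r ?nnegrE// (le_trans _ cB).
exists (Num.sqrt (B ^+ 2 + B ^+ 2)) => l /=.
rewrite sqrrN ler_wsqrtr// lerD// fM// => t; [exact: cos_max|exact: sin_max].
Qed.

(** * Summing the variations *)

Lemma sinc2_norm (R : realType) (x : R) : sinc2 `|x| = sinc2 x.
Proof.
rewrite /sinc2; have [x0|x0] := leP 0 x; first by rewrite ger0_norm.
by rewrite ltr0_norm// sinN invrN mulrNN.
Qed.

(** The comparison of [sinc2] is applied at [|l| * x] and [|l| * y], by parity;
    for [l = 0] both sides are 0. *)
Lemma le_variation_fourier_psi (R : realType) (x y : R) (l : int) :
    0 < y -> y <= x -> 2 * x < pi ->
  ComplexField.Normc.normc (fourier_coef (psi x) l - fourier_coef (psi y) l)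
  <= 16 * ((1 + `|l%:~R| * y)^-1 - (1 + `|l%:~R| * x)^-1).
Proof.
move=> y0 yx xpi; have x0 := lt_le_trans y0 yx.
have ypi : 2 * y < pi by lra.
have [->|l0] := eqVneq l 0.
  by rewrite !fourier_psi0//= normr0 !mul0r !subrr mulr0 expr0n /= addr0 sqrtr0.
rewrite !fourier_psi//= subrr expr0n/= addr0 sqrtr_sqr.
have L0 : 0 < `|l%:~R| :> R by rewrite normr_gt0 intr_eq0.
rewrite -(sinc2_norm (_ * x)) -(sinc2_norm (_ * y)) !normrM.
rewrite (gtr0_norm x0) (gtr0_norm y0).
by apply: le_variation_sinc2; [exact: mulr_gt0|rewrite ler_pM2l].
Qed.

Unset Implicit Arguments.

(* eps is indexed from 1; the value eps 0 plays no role *)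
Theorem theorem5p10 (R : realType) (eps : nat -> R)
    (eps_gt0 : forall k : nat, (1 <= k)%N -> 0 < eps k)
    (eps_noninc : forall k : nat, (1 <= k)%N -> eps k.+1 <= eps k)
    (eps_cvg0 : eps k @[k --> \oo] --> (0 : R)) :
  (ereal_sup [set \sum_(1 <= k <oo)
      (ComplexField.Normc.normc (fourier_coef (psi (eps k)) l
                        - fourier_coef (psi (eps k.+1)) l))%:E
    | l in [set: int]] < +oo)%E.
Proof.
pose a l k : R := ComplexField.Normc.normc
  (fourier_coef (psi (eps k)) l - fourier_coef (psi (eps k.+1)) l).
have a0 l k : 0 <= a l k.
  by rewrite /a; case: (_ - _) => u v /=; exact: sqrtr_ge0.
have a_bounded k : (1 <= k)%N -> exists C, forall l, a l k <= C.
  move=> k1; have [B HB] := fourier_psi_bounded (eps_gt0 k k1).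
  have [C HC] := fourier_psi_bounded (eps_gt0 k.+1 isT).
  exists (B + C) => l; apply: le_trans (le_normcD _ _) _.
  by rewrite normcN lerD.
have head_bounded n : exists D, forall l, \sum_(1 <= k < n) a l k <= D.
  elim: n => [|n [D HD]]; first by exists 0 => l; rewrite big_geq.
  have [n0|n1] := posnP n; first by exists 0 => l; rewrite n0 big_geq.
  have [C HC] := a_bounded n n1.
  by exists (D + C) => l; rewrite big_nat_recr//= lerD.
(* from [K] on, [2 * eps k < 2 <= pi] *)
have [K K1 epsK] : exists2 K, (1 <= K)%N & forall k, (K <= k)%N -> eps k < 1.
  have /cvgrPdist_lt /(_ 1 ltr01)[K _ HK] := eps_cvg0.
  exists K.+1 => // k Kk; have := HK k (ltnW Kk); rewrite /= sub0r normrN.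
  by apply: le_lt_trans; exact: ler_norm.
(* the terms before [K] are bounded separately, as their arcs may wrap *)
have [D headD] := head_bounded K.
suff total l : (\sum_(1 <= k <oo) (a l k)%:E <= (D + 16)%:E)%E.
  apply: (@le_lt_trans _ _ (D + 16)%:E); last exact: ltry.
  by apply: ge_ereal_sup => _ [l _ <-]; exact: total.
apply: lime_le.
  by apply: is_cvg_nneseries => k _ _; rewrite lee_fin.
exists K => // n /= Kn; rewrite sumEFin lee_fin (big_cat_nat K1 Kn)/= lerD//.
pose u k : R := 16 * (1 + `|l%:~R| * eps k)^-1.
have tail k : (K <= k)%N -> a l k <= u k.+1 - u k.
  move=> Kk; have k1 : (1 <= k)%N := leq_trans K1 Kk.
  rewrite -mulrBr; apply: le_variation_fourier_psi.
  - exact: eps_gt0.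
  - exact: eps_noninc.
  - by have := epsK k Kk; have := pi_ge2 R; lra.
have u01 k : (K <= k)%N -> 0 <= u k <= 16.
  move=> Kk; have h : 1 <= 1 + `|l%:~R| * eps k.
    by rewrite lerDl mulr_ge0// ltW// eps_gt0// (leq_trans K1).
  rewrite mulr_ge0 ?invr_ge0 ?(le_trans _ h)//= ler_piMr//.
  by rewrite invf_le1// (lt_le_trans _ h).
apply: (@le_trans _ _ (\sum_(K <= k < n) (u k.+1 - u k))).
  by rewrite ler_sum_nat// => k /andP[Kk _]; exact: tail.
rewrite telescope_sumr//.
by have := u01 n Kn; have := u01 K (leqnn K); lra.
Qed.
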